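(* Suppose that $f:\mathsf{On}\to\mathsf{On}$ is a normal function and $\langle f^\xi\rangle_{\xi\in\mathsf{On}}$ is its hyperation. Let $g$ be a left adjoint for $f$, with cohyperation $\langle g^\xi\rangle_{\xi\in\mathsf{On}}$. Then $g^\xi$ is a left adjoint of $f^\xi$ for all ordinals $\xi$.
   Context: $\mathsf{On}$ is the class of all ordinals. A function $f:\mathsf{On}\to\mathsf{On}$ is normal if it is strictly increasing and continuous, i.e. $f(\lambda)=\sup_{\xi<\lambda}f(\xi)$ for every limit ordinal $\lambda$. A function $g:\mathsf{On}\to\mathsf{On}$ is initial if the image under $g$ of every initial segment (set of the form $[0,\beta)$) is again an initial segment. A weak hyperation of a normal function $f$ is a family $\langle h^\xi\rangle_{\xi\in\mathsf{On}}$ of normal functions such that $h^0=\mathrm{id}$, $h^1=f$, and $h^{\xi+\zeta}=h^\xi\circ h^\zeta$ for all ordinals $\xi,\zeta$. The hyperation of $f$ is the unique weak hyperation $\langle f^\xi\rangle_{\xi\in\mathsf{On}}$ of $f$ which is pointwise minimal, i.e. $f^\xi(\zeta)\le h^\xi(\zeta)$ for every weak hyperation $\langle h^\xi\rangle_{\xi\in\mathsf{On}}$ of $f$ and all ordinals $\xi,\zeta$; every normal function has a hyperation. For a normal function $f$, a function $g:\mathsf{On}\to\mathsf{On}$ is a left adjoint for $f$ if for all ordinals $\alpha,\beta$: $\alpha=f(\beta)\Rightarrow g(\alpha)=\beta$, and $\alpha<f(\beta)\Rightarrow g(\alpha)<\beta$. Left adjoints of normal functions are always initial. A weak cohyperation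 of an initial function $g$ is a family $\langle h^\xi\rangle_{\xi\in\mathsf{On}}$ of initial functions such that $h^0=\mathrm{id}$, $h^1=g$, and $h^{\xi+\zeta}=h^\zeta\circ h^\xi$ for all ordinals $\xi,\zeta$. The cohyperation of $g$ is the weak cohyperation $\langle g^\xi\rangle_{\xi\in\mathsf{On}}$ of $g$ which is pointwise maximal, i.e. $g^\xi(\zeta)\ge h^\xi(\zeta)$ for every weak cohyperation $\langle h^\xi\rangle_{\xi\in\mathsf{On}}$ of $g$ and all ordinals $\xi,\zeta$. *)

(* Defs.v *)
From HB Require Import structures.
From mathcomp Require Import all_boot all_order.
From mathcomp Require Import boolp classical_sets.

Set Implicit Arguments.
Unset Strict Implicit.
Unset Printing Implicit Defensive.

Import Order.TTheory.

Local Open Scope order_scope.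
Local Open Scope classical_set_scope.
Local Open Scope quotient_scope.

(* The types of one fixed universe play the role of sets. A well-founded tree
   with branching types in that universe has the rank
     rank (node f) = sup_a (rank (f a) + 1),
   the ranks are exactly the ordinals, and On is the quotient of the trees by
   equality of ranks. The relations [tle] and [tlt] compare ranks. *)
Inductive tree : Type := node (A : Type) of A -> tree.

Definition branching (t : tree) : Type := let: node A _ := t in A.
Definition child (t : tree) : branching t -> tree :=
  let: node _ f := t in f.

Fixpoint tle (s t : tree) : Prop :=
  let: node _ f := s in forall a, exists b : branching t, tle (f a) (child b).

Definition tlt (s t : tree) : Prop := exists b : branching t, tle s (child b).

Lemma tree_child_ind (P : tree -> Prop) :
  (forall t, (forall b : branching t, P (child b)) -> P t) -> forall t, P t.
Proof. by move=> Pchild; elim=> A f IH; apply: Pchild. Qed.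

Lemma tleE s t : tle s t <-> forall a : branching s, tlt (child a) t.
Proof. by case: s. Qed.

Lemma tle_refl s : tle s s.
Proof. by elim/tree_child_ind: s => s IH; apply/tleE => a; exists a. Qed.

Lemma tle_trans s t u : tle s t -> tle t u -> tle s u.
Proof.
elim/tree_child_ind: s t u => s IH t u /tleE st /tleE tu; apply/tleE => a.
have [b sab] := st a; have [c tbc] := tu b.
by exists c; apply: IH tbc.
Qed.

Lemma tlt_le_trans s t u : tlt s t -> tle t u -> tlt s u.
Proof.
move=> [b sb] /tleE /(_ b)[c bc]; exists c; exact: tle_trans bc.
Qed.

Lemma tle_lt_trans s t u : tle s t -> tlt t u -> tlt s u.
Proof. by move=> st [c tc]; exists c; apply: tle_trans tc. Qed.

Lemma tlt_child t (b : branching t) : tlt (child b) t.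
Proof. by exists b; apply: tle_refl. Qed.

Lemma tltW s t : tlt s t -> tle s t.
Proof.
elim/tree_child_ind: s t => s IH t [b sb]; apply/tleE => a; exists b.
by apply: IH; apply: tlt_le_trans sb; apply: tlt_child.
Qed.

Lemma tlt_nge s t : tlt s t -> ~ tle t s.
Proof.
elim/tree_child_ind: t s => t IH s [b sb] /tleE /(_ b) bs.
exact: IH (tlt_le_trans bs sb) (tle_refl _).
Qed.

Lemma tle_or_gt s t : tle s t \/ tlt t s.
Proof.
elim/tree_child_ind: s t => s IH t.
have [?|/existsNP[a nlt]] := pselect (forall a : branching s, tlt (child a) t).
  by left; apply/tleE.
right; exists a; apply/tleE => b.
by have [le|//] := IH a (child b); case: nlt; exists b.
Qed.

HB.instance Definition _ := gen_eqMixin tree.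
HB.instance Definition _ := gen_choiceMixin tree.

Definition teq (s t : tree) : bool := `[< tle s t /\ tle t s >].

Lemma teq_refl : reflexive teq.
Proof. by move=> s; apply/asboolP; split; apply: tle_refl. Qed.

Lemma teq_sym : symmetric teq.
Proof. by move=> s t; apply/asboolP/asboolP => -[]. Qed.

Lemma teq_trans : transitive teq.
Proof.
move=> t s u /asboolP[st ts] /asboolP[tu ut]; apply/asboolP; split.
  exact: tle_trans tu.
exact: tle_trans ts.
Qed.

Canonical teq_equiv := EquivRel teq teq_refl teq_sym teq_trans.

Definition On := {eq_quot teq}.
HB.instance Definition _ := Choice.on On.
HB.instance Definition _ := EqQuotient.on On.

Definition rank (t : tree) : On := \pi_On t.

Lemma rank_repr (a : On) : rank (repr a) = a.
Proof. exact: reprK. Qed.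

Lemma rank_eq s t : rank s = rank t <-> tle s t /\ tle t s.
Proof.
rewrite /rank; split=> [/eqmodP/asboolP //|st].
by apply/eqmodP/asboolP.
Qed.

Lemma repr_rank t : tle (repr (rank t)) t /\ tle t (repr (rank t)).
Proof. by apply/rank_eq; rewrite rank_repr. Qed.

Definition On_le (a b : On) : bool := `[< tle (repr a) (repr b) >].
Definition On_lt (a b : On) : bool := `[< tlt (repr a) (repr b) >].

Lemma On_lt_def a b : On_lt a b = (b != a) && On_le a b.
Proof.
apply/asboolP/andP => [lt|[/eqP neq /asboolP le]].
  split; last by apply/asboolP/tltW.
  by apply/eqP => ba; apply: (tlt_nge lt); rewrite ba; apply: tle_refl.
have [ba|//] := tle_or_gt (repr b) (repr a).
by case: neq; rewrite -(rank_repr a) -(rank_repr b); apply/rank_eq.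
Qed.

Lemma On_le_anti : antisymmetric On_le.
Proof.
move=> a b /andP[/asboolP ab /asboolP ba].
by rewrite -(rank_repr a) -(rank_repr b); apply/rank_eq.
Qed.

Lemma On_le_trans : transitive On_le.
Proof.
by move=> b a c /asboolP ab /asboolP bc; apply/asboolP; apply: tle_trans bc.
Qed.

Lemma On_le_total : total On_le.
Proof.
move=> a b; apply/orP.
have [ab|ba] := tle_or_gt (repr a) (repr b); first by left; apply/asboolP.
by right; apply/asboolP/tltW.
Qed.

Fact On_display : Order.disp_t. Proof. exact: Order.Disp tt tt. Qed.

HB.instance Definition _ := Order.isOrder.Build On_display On
  On_lt_def (fun _ _ => erefl) (fun _ _ => erefl)
  On_le_anti On_le_trans On_le_total.

Lemma rank_le s t : rank s <= rank t <-> tle s t.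
Proof.
have [s1 s2] := repr_rank s; have [t1 t2] := repr_rank t.
split=> [/asboolP st|st]; last apply/asboolP.
  exact: tle_trans s2 (tle_trans st t1).
exact: tle_trans s1 (tle_trans st t2).
Qed.

Lemma rank_lt s t : rank s < rank t <-> tlt s t.
Proof.
rewrite ltNge; split=> [/negP nle|lt].
  by have [/rank_le|//] := tle_or_gt t s.
by apply/negP => /rank_le; apply: tlt_nge.
Qed.

Lemma On_lt_wf : well_founded (fun a b : On => a < b).
Proof.
suff acc t (a : On) : a <= rank t -> Acc (fun a b : On => a < b) a.
  by move=> a; apply: (acc (repr a)); rewrite rank_repr.
elim/tree_child_ind: t a => t IH a at_; constructor => b ba.
have := lt_le_trans ba at_; rewrite -(rank_repr b) => /rank_lt[c bc].
by apply: (IH c); apply/rank_le.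
Qed.

Lemma On_isLub_ex (A : Type) (F : A -> On) : exists m, isLub (range F) m.
Proof.
exists (rank (node (fun p : {i : A & branching (repr (F i))} =>
  child (projT2 p)))); split=> [_ [i _ <-]|b ub_b].
  rewrite -[F i]rank_repr; apply/rank_le/tleE => a.
  by exists (existT _ i a); apply: tle_refl.
rewrite -[b]rank_repr; apply/rank_le/tleE => -[i a] /=.
apply: tlt_le_trans (tlt_child a) _.
by apply/rank_le; rewrite !rank_repr; apply: ub_b; exists i.
Qed.

Fixpoint proper_subtree (t : tree) : Type :=
  let: node A f := t in {a : A & option (proper_subtree (f a))}.

Fixpoint subtree_at (t : tree) : proper_subtree t -> tree :=
  match t with
  | node A f => fun p =>
    match projT2 p with Some q => subtree_at q | None => f (projT1 p) end
  end.

Lemma subtree_at_lt t (p : proper_subtree t) : tlt (subtree_at p) t.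
Proof.
elim: t p => A f IH [a [q|]] /=; exists a; last exact: tle_refl.
exact/tltW/IH.
Qed.

Lemma On_lt_small (a : On) :
  exists (A : Type) (F : A -> On), [set b : On | b < a] = range F.
Proof.
exists (proper_subtree (repr a)), (fun p => rank (subtree_at p)).
rewrite -{1}(rank_repr a); apply/seteqP; split=> b /=; last first.
  by move=> [p _ <-]; apply/rank_lt/subtree_at_lt.
elim: (repr a) b => {a} A f IH b.
rewrite -{1}(rank_repr b) => /rank_lt[/= a /rank_le].
rewrite rank_repr le_eqVlt => /predU1P[->|/IH[p _ <-]].
  by exists (existT _ a None).
by exists (existT _ a (Some p)).
Qed.

Definition On0 : On := rank (node (fun v : void => match v with end)).
Definition On_succ (a : On) : On := rank (node (fun _ : unit => repr a)).
Definition On1 : On := On_succ On0.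

Lemma On_le0x (a : On) : On0 <= a.
Proof. by rewrite -(rank_repr a); apply/rank_le; case. Qed.

Lemma On_ltS (a b : On) : (a < On_succ b) = (a <= b).
Proof.
rewrite -{1}(rank_repr a); apply/idP/idP => [/rank_lt[_ /= ab]|ab].
  by rewrite -(rank_repr a) -(rank_repr b); apply/rank_le.
by apply/rank_lt; exists tt; apply/rank_le; rewrite !rank_repr.
Qed.

Definition On_limit (l : On) : Prop := l <> On0 /\ forall a, l <> On_succ a.

Fixpoint tadd (s t : tree) : tree :=
  let: node B g := t in
  node (fun x : branching s + B =>
    match x with inl a => child a | inr b => tadd s (g b) end).

Definition On_add (a b : On) : On := rank (tadd (repr a) (repr b)).

Lemma tlt_add s t u :
  tlt u (tadd s t) <->
  tlt u s \/ exists b : branching t, tle u (tadd s (child b)).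
Proof.
case: t => B g /=; split=> [[[a|b] /=]|[[a ua]|[b ub]]].
- by left; exists a.
- by right; exists b.
- by exists (inl a).
- by exists (inr b).
Qed.

Lemma tadd_le s s' t t' :
  tle s s' -> tle t t' -> tle (tadd s t) (tadd s' t').
Proof.
move=> ss'; elim/tree_child_ind: t t' => t IH t' /tleE tt'.
apply/tleE => x; apply/tlt_add.
have /tlt_add[xs|[b xb]] := tlt_child x; first by left; apply: tlt_le_trans ss'.
by right; have [b' bb'] := tt' b; exists b'; apply: tle_trans xb (IH b _ bb').
Qed.

Lemma rank_add s t : On_add (rank s) (rank t) = rank (tadd s t).
Proof.
have [s1 s2] := repr_rank s; have [t1 t2] := repr_rank t.
by apply/rank_eq; split; apply: tadd_le.
Qed.

Lemma On_lt_add (a b c : On) :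
  c < On_add a b <-> c < a \/ exists2 d, d < b & c <= On_add a d.
Proof.
rewrite -(rank_repr a) -(rank_repr b) -(rank_repr c) rank_add rank_lt tlt_add.
rewrite rank_lt; split=> -[?|]; try by left.
  move=> [d cd]; right; exists (rank (child d)); first exact/rank_lt/tlt_child.
  by rewrite rank_add; apply/rank_le.
move=> [d]; rewrite -(rank_repr d) rank_add => /rank_lt[x dx] /rank_le cd.
by right; exists x; apply: tle_trans cd _; apply: tadd_le; first exact: tle_refl.
Qed.

Lemma On_eq_lt (a b : On) : (forall c, c < a <-> c < b) -> a = b.
Proof.
move=> ab; apply: le_anti; rewrite !leNgt.
by apply/andP; split; apply/negP => /ab; rewrite ltxx.
Qed.

Lemma On_add0 (a : On) : On_add a On0 = a.
Proof.
apply: On_eq_lt => c; rewrite On_lt_add; split; last by left.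
by case=> // -[d]; rewrite ltNge On_le0x.
Qed.

Lemma On_add_le (a b d : On) : b <= d -> On_add a b <= On_add a d.
Proof.
move=> bd; rewrite leNgt; apply/negP => /On_lt_add lt.
suff: On_add a d < On_add a d by rewrite ltxx.
apply/On_lt_add; case: lt => [?|[x xb le]]; [by left|right].
by exists x => //; apply: lt_le_trans bd.
Qed.

Lemma On_addS (a b : On) : On_add a (On_succ b) = On_succ (On_add a b).
Proof.
apply: On_eq_lt => c; rewrite On_lt_add On_ltS; split=> [[ca|[d]]|cab].
- by apply: (le_trans (ltW ca)); rewrite -{1}(On_add0 a) On_add_le ?On_le0x.
- by rewrite On_ltS => db cd; apply: le_trans cd _; apply: On_add_le.
- by right; exists b; rewrite // On_ltS.
Qed.

Lemma On_add_limit (a l : On) : On_limit l ->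
  isLub (On_add a @` [set x | x < l]) (On_add a l).
Proof.
move=> [l0 lS]; split=> [_ [x /ltW xl <-]|c ub_c]; first exact: On_add_le.
rewrite leNgt; apply/negP => /On_lt_add[ca|[d dl cad]].
  have: On_add a On0 <= c.
    apply: ub_c; exists On0 => //=.
    by rewrite lt_neqAle On_le0x andbT; apply/eqP => /esym.
  by rewrite On_add0 leNgt ca.
have: On_add a (On_succ d) <= c.
  apply: ub_c; exists (On_succ d) => //=.
  rewrite ltNge le_eqVlt; apply/negP => /predU1P[/lS//|].
  by rewrite On_ltS leNgt dl.
by rewrite On_addS leNgt On_ltS cad.
Qed.

Definition normal (f : On -> On) : Prop :=
  (forall a b, a < b -> f a < f b) /\
  (forall l, On_limit l -> isLub (f @` [set x | x < l]) (f l)).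

Definition initial (g : On -> On) : Prop :=
  forall b, exists c, g @` [set x | x < b] = [set y | y < c].

Definition weak_hyperation (f : On -> On) (h : On -> On -> On) : Prop :=
  [/\ forall xi, normal (h xi),
      forall a, h On0 a = a,
      forall a, h On1 a = f a &
      forall xi zeta a, h (On_add xi zeta) a = h xi (h zeta a)].

Definition hyperation (f : On -> On) (h : On -> On -> On) : Prop :=
  weak_hyperation f h /\
  forall h', weak_hyperation f h' -> forall xi a, h xi a <= h' xi a.

Definition left_adjoint (f g : On -> On) : Prop :=
  forall a b, (a = f b -> g a = b) /\ (a < f b -> g a < b).

(* The order of composition is reversed with respect to [weak_hyperation]. *)
Definition weak_cohyperation (g : On -> On) (h : On -> On -> On) : Prop :=
  [/\ forall xi, initial (h xi),
      forall a, h On0 a = a,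
      forall a, h On1 a = g a &
      forall xi zeta a, h (On_add xi zeta) a = h zeta (h xi a)].

Definition cohyperation (g : On -> On) (h : On -> On -> On) : Prop :=
  weak_cohyperation g h /\
  forall h', weak_cohyperation g h' -> forall xi a, h' xi a <= h xi a.

(* Main.v *)
(* By recursion on [xi] we build a weak cohyperation [h] of [g]: a decomposable
   exponent is handled by composition, and at an additively indecomposable
   [xi > 1] one lets the [h zeta], [zeta < xi], decrease the argument to a
   common fixed point and takes its position among these fixed points. Every
   [h xi] is initial and onto, so [L xi b := min {a | h xi a = b}] is the unique
   function with left adjoint [h xi]; uniqueness turns the composition law of [h]
   into that of [L], and [L] is a weak hyperation of [f] lying below every other
   one, so it is the hyperation. Any weak cohyperation [k] of [g] satisfies
   [a < L xi b -> k xi a < b]; the maximal one also dominates [h], hence takes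
   the value [b] at [L xi b]. *)
From mathcomp Require Import all_boot all_order.
From mathcomp Require Import boolp classical_sets.
Require Import Defs.

Set Implicit Arguments.
Unset Strict Implicit.
Unset Printing Implicit Defensive.

Import Order.TTheory.

Local Open Scope order_scope.
Local Open Scope classical_set_scope.

(** * Ordinals: well-founded induction, successors and suprema *)

Lemma On_ind (P : On -> Prop) :
  (forall a, (forall b, b < a -> P b) -> P a) -> forall a, P a.
Proof. by move=> IH; apply: (well_founded_ind On_lt_wf) => a; apply: IH. Qed.

Lemma On_least (P : On -> Prop) (a : On) :
  P a -> exists b, [/\ P b, b <= a & forall c, P c -> b <= c].
Proof.
elim/On_ind: a => a IH Pa.
have [[b ba Pb]|nb] := pselect (exists2 b, b < a & P b).
  have [c [Pc cb cP]] := IH b ba Pb; exists c; split=> //.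
  exact: ltW (le_lt_trans cb ba).
exists a; split=> // c Pc; rewrite leNgt; apply/negP => ca.
by apply: nb; exists c.
Qed.

Lemma On_succ_gt (a : On) : a < On_succ a.
Proof. by rewrite On_ltS. Qed.

Lemma On_succ_le (a b : On) : (On_succ a <= b) = (a < b).
Proof. by rewrite leNgt On_ltS -ltNge. Qed.

Lemma On_lt0 (a : On) : (a < On0) = false.
Proof. by rewrite ltNge On_le0x. Qed.

Lemma On_lt1 (a : On) : a < On1 -> a = On0.
Proof. by rewrite On_ltS => a0; apply: le_anti; rewrite a0 On_le0x. Qed.

Lemma On_gt0 (a : On) : a <> On0 -> On0 < a.
Proof. by move=> /eqP a0; rewrite lt_neqAle eq_sym a0 On_le0x. Qed.

Lemma On_cases a : [\/ a = On0, exists b, a = On_succ b | On_limit a].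
Proof.
have [->|a0] := pselect (a = On0); first exact: Or31.
have [aS|naS] := pselect (exists b, a = On_succ b); first exact: Or32.
by apply: Or33; split=> // b ab; apply: naS; exists b.
Qed.

Lemma On_le_of_lt (a b : On) : (forall c, c < a -> c < b) -> a <= b.
Proof. by move=> ab; rewrite leNgt; apply/negP => /ab; rewrite ltxx. Qed.

Lemma On_limit_succ (l a : On) : On_limit l -> a < l -> On_succ a < l.
Proof.
move=> [_ lS] al; rewrite lt_neqAle On_succ_le al andbT.
by apply/eqP => /esym/lS.
Qed.

Lemma On_lub_lt_ex (F : On -> On) (a : On) :
  exists m, isLub (F @` [set x | x < a]) m.
Proof.
have [A [G GE]] := On_lt_small a; have [m mP] := On_isLub_ex (F \o G).
by exists m; rewrite GE image_comp.
Qed.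

Lemma lub_ltP (S : set On) (m a : On) :
  isLub S m -> a < m -> exists2 s, S s & a < s.
Proof.
move=> [_ mlub] am; apply: contrapT => nS.
suff /mlub: ubound S a by rewrite leNgt am.
by move=> s Ss; rewrite leNgt; apply/negP => as_; apply: nS; exists s.
Qed.

(** * Ordinal addition and additively indecomposable ordinals *)

Lemma On_add_lt (a b c : On) : b < c -> On_add a b < On_add a c.
Proof. by move=> bc; apply/On_lt_add; right; exists b. Qed.

Lemma On_le_addl (a b : On) : b <= On_add a b.
Proof.
elim/On_ind: b => b IH; apply: On_le_of_lt => c cb; apply/On_lt_add.
by right; exists c => //; apply: IH.
Qed.

Lemma On_le_addr (a b : On) : a <= On_add a b.
Proof. by rewrite -{1}[a]On_add0 On_add_le // On_le0x. Qed.

Lemma On_add_inj a : injective (On_add a).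
Proof.
by move=> b c bc; have [/(On_add_lt a)|/(On_add_lt a)|//] := ltgtP b c;
  rewrite bc ltxx.
Qed.

Lemma On_addA a b c : On_add (On_add a b) c = On_add a (On_add b c).
Proof.
elim/On_ind: c => c IH; apply: On_eq_lt => x; split.
- move=> /On_lt_add[/On_lt_add[xa|[d db xd]]|[d dc]].
  + by apply/On_lt_add; left.
  + apply/On_lt_add; right; exists d => //.
    exact: lt_le_trans db (On_le_addr _ _).
  + rewrite IH // => xd; apply: le_lt_trans xd _.
    by do 2 apply: On_add_lt.
- move=> /On_lt_add[xa|[d /On_lt_add[db|[e ec de]] xd]]; apply/On_lt_add.
  + by left; apply: lt_le_trans xa (On_le_addr _ _).
  + by left; apply/On_lt_add; right; exists d.
  + right; exists e => //; rewrite IH //.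
    exact: le_trans xd (On_add_le _ de).
Qed.

Lemma On_sub (a b : On) : a <= b -> exists2 e, e <= b & On_add a e = b.
Proof.
move=> ab.
have [e [be eb emin]] := @On_least (fun e => b <= On_add a e) b (On_le_addl _ _).
exists e => //; apply: le_anti; rewrite be andbT leNgt.
apply/negP => /On_lt_add[|[d de /emin]]; first by rewrite ltNge ab.
by rewrite leNgt de.
Qed.

(** Both [On0] and [On1] satisfy this, which is why later statements exclude them separately. *)
Definition indecomposable (xi : On) : Prop :=
  forall a b, a < xi -> b < xi -> On_add a b < xi.

(** Write [xi] as [a + e] with [e <= xi]; indecomposability rules out [e < xi]. *)
Lemma indecomposable_absorb xi a :
  indecomposable xi -> a < xi -> On_add a xi = xi.
Proof.
move=> ixi axi; have [e] := On_sub (ltW axi).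
rewrite le_eqVlt => /predU1P[-> //|exi] ae.
by have := ixi a e axi exi; rewrite ae ltxx.
Qed.

Lemma decomposableP xi : ~ indecomposable xi ->
  exists a b, [/\ a < xi, b < xi & On_add a b = xi].
Proof.
move=> /existsNP[a /existsNP[b /not_implyP[axi /not_implyP[bxi nlt]]]].
have [e exi ae] := On_sub (ltW axi); exists a, e; split=> //.
apply: le_lt_trans bxi; rewrite leNgt; apply/negP => /(On_add_lt a).
by rewrite ae; apply: nlt.
Qed.

Lemma indecomposable0 : indecomposable On0.
Proof. by move=> a b; rewrite On_lt0. Qed.

Lemma indecomposable1 : indecomposable On1.
Proof. by move=> a b /On_lt1-> /On_lt1->; rewrite On_add0 On_succ_gt. Qed.

(** Well-founded induction fitted to families that are additive in the exponent: composition settles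
    decomposable exponents, so the real work is at indecomposable ones above [On1]. *)
Lemma exponent_ind (P : On -> Prop) : P On0 -> P On1 ->
  (forall a b, P a -> P b -> P (On_add a b)) ->
  (forall xi, indecomposable xi -> xi <> On0 -> xi <> On1 ->
     (forall zeta, zeta < xi -> P zeta) -> P xi) ->
  forall xi, P xi.
Proof.
move=> P0 P1 PD Pi; elim/On_ind => xi IH.
have [ixi|/decomposableP[a [b [axi bxi <-]]]] := pselect (indecomposable xi).
  have [->//|xi0] := pselect (xi = On0); have [->//|xi1] := pselect (xi = On1).
  exact: Pi.
by apply: PD; apply: IH.
Qed.

(** * Initial functions *)

Lemma initialP g :
  initial g <-> forall x y, y < g x -> exists2 x', x' < x & g x' = y.
Proof.
split=> [ig x y yx|gP b].
  have [c cE] := ig (On_succ x).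
  have: [set y | y < c] (g x) by rewrite -cE; exists x => //; apply: On_succ_gt.
  move=> /= /(lt_trans yx) yc.
  have : [set y | y < c] y by [].
  rewrite -cE => -[x' /=]; rewrite On_ltS le_eqVlt => /predU1P[->|x'x gx'].
    by move=> gxy; rewrite gxy ltxx in yx.
  by exists x'.
have [c [nc _ cmin]] : exists c, [/\ ~ (g @` [set x | x < b]) c, c <= b &
    forall d, ~ (g @` [set x | x < b]) d -> c <= d].
  (* The bound [b] is itself missed: [g x = b] with [x < b] forces [g x' = x] for some [x' < x], an
     infinite descent. *)
  apply: On_least => -[x /=]; elim/On_ind: b x => b IH x xb gxb.
  have [x' x'x gx'] : exists2 x', x' < x & g x' = x by apply: gP; rewrite gxb.
  exact: IH xb x' x'x gx'.
exists c; apply/seteqP; split=> y /=; last first.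
  by move=> yc; apply: contrapT => /cmin; rewrite leNgt yc.
move=> [x xb <-]; rewrite ltNge; apply/negP; rewrite le_eqVlt.
move=> /predU1P[cx|/gP[x' x'x gx']]; apply: nc; first by exists x.
by exists x' => //=; apply: lt_trans xb.
Qed.

(** A least [x] with [x < g x] would be a value [g x'] with [x' < x], and then [x' < g x']. *)
Lemma initial_le g x : initial g -> g x <= x.
Proof.
move=> /initialP gP; elim/On_ind: x => x IH; rewrite leNgt; apply/negP => xgx.
have [x' x'x gx'] := gP _ _ xgx.
by have := IH _ x'x; rewrite gx' leNgt x'x.
Qed.

Lemma initial_onto g x y : initial g -> y <= g x -> exists2 x', x' <= x & g x' = y.
Proof.
move=> /initialP gP; rewrite le_eqVlt => /predU1P[->|/gP[x' /ltW]]; first by exists x.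
by exists x'.
Qed.

Lemma initial_comp f g : initial f -> initial g -> initial (f \o g).
Proof.
move=> /initialP fP /initialP gP; apply/initialP => x y /= /fP[z /gP[x' x'x <-] fz].
by exists x'.
Qed.

(** * Left adjoints *)

Lemma left_adjoint_initial f g : left_adjoint f g -> initial g.
Proof.
move=> fg; apply/initialP => x y yx; exists (f y); last by apply: (fg _ y).1.
rewrite ltNge; apply/negP; rewrite le_eqVlt => /predU1P[/(fg _ _).1 xy|/(fg _ _).2].
  by rewrite xy ltxx in yx.
by rewrite ltNge (ltW yx).
Qed.

Lemma left_adjointK f g : left_adjoint f g -> cancel f g.
Proof. by move=> fg b; apply: (fg _ b).1. Qed.

Lemma left_adjoint_lt f g a b : left_adjoint f g -> a < f b -> g a < b.
Proof. by move=> fg; apply: (fg a b).2. Qed.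

Lemma left_adjoint_homo f g : left_adjoint f g -> {homo f : a b / a < b}.
Proof.
move=> fg a b ab; rewrite ltNge; apply/negP; rewrite le_eqVlt => /predU1P[|].
  by move=> /(can_inj (left_adjointK fg)) ba; rewrite ba ltxx in ab.
move=> /(left_adjoint_lt fg); rewrite (left_adjointK fg).
by rewrite ltNge (ltW ab).
Qed.

Lemma left_adjoint_uniq f f' g : left_adjoint f g -> left_adjoint f' g -> f =1 f'.
Proof.
move=> fg f'g b; have [lt|lt|//] := ltgtP (f b) (f' b).
  by have := left_adjoint_lt f'g lt; rewrite (left_adjointK fg) ltxx.
by have := left_adjoint_lt fg lt; rewrite (left_adjointK f'g) ltxx.
Qed.

Lemma left_adjoint_comp f1 g1 f2 g2 : left_adjoint f1 g1 -> left_adjoint f2 g2 ->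
  left_adjoint (f1 \o f2) (g2 \o g1).
Proof.
move=> fg1 fg2 a b; split=> /= [->|].
  by rewrite (left_adjointK fg1) (left_adjointK fg2).
by move=> /(left_adjoint_lt fg1)/(left_adjoint_lt fg2).
Qed.

(** Take for [f b] the least preimage of [b]; by initiality, [b <= g a] yields a preimage of [b] at
    or below [a]. *)
Lemma initial_surj_adjoint g :
  initial g -> (forall b, exists a, g a = b) -> exists f, left_adjoint f g.
Proof.
move=> ig gs.
have /choice[f fP] : forall b, exists a, g a = b /\ forall c, g c = b -> a <= c.
  move=> b; have [a ga] := gs b.
  by have [c [? _ ?]] := @On_least (fun a => g a = b) a ga; exists c.
exists f => a b; have [gfb fmin] := fP b; split=> [-> //|ab].
rewrite ltNge; apply/negP => /(initial_onto ig)[c ca /fmin].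
by rewrite leNgt (le_lt_trans ca ab).
Qed.

(** * Normal functions *)

Lemma normal_homo_le f : normal f -> {homo f : a b / a <= b}.
Proof.
move=> [fh _] a b; rewrite le_eqVlt => /predU1P[-> //|/fh].
exact: ltW.
Qed.

(** A supremum that is not attained is a limit ordinal, where continuity applies. *)
Lemma normal_lub f S m :
  normal f -> S !=set0 -> isLub S m -> isLub (f @` S) (f m).
Proof.
move=> nf [s0 Ss0] lm; split=> [_ [s Ss <-]|c cub].
  by apply: normal_homo_le => //; apply: lm.1.
have [Sm|nSm] := pselect (S m); first by apply: cub; exists m.
have Slt s : S s -> s < m.
  move=> Ss; rewrite lt_neqAle (lm.1 _ Ss) andbT; apply/eqP => sm.
  by rewrite sm in Ss.
have ml : On_limit m.
  split=> [m0|a ma]; first by have := Slt _ Ss0; rewrite m0 On_lt0.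
  have am : a < m by rewrite ma On_succ_gt.
  by have [s /Slt] := lub_ltP lm am; rewrite ma On_ltS leNgt => /negP.
apply: (nf.2 m ml).2 => _ [x /= xm <-].
have [s Ss xs] := lub_ltP lm xm.
by apply: le_trans (ltW (nf.1 _ _ xs)) _; apply: cub; exists s.
Qed.

Lemma normal_comp f g : normal f -> normal g -> normal (f \o g).
Proof.
move=> nf ng; split=> [a b /ng.1/nf.1 //|l ll].
rewrite -image_comp; apply: normal_lub => //; last exact: ng.2.
by exists (g On0), On0 => //=; apply: On_gt0 ll.1.
Qed.

(** * Transfinite recursion and order types *)

Lemma On_rec_ex (T : Type) (t0 : T) (R : On -> (On -> T) -> T -> Prop) :
  (forall xi u v t, (forall zeta, zeta < xi -> u zeta = v zeta) ->
     R xi u t -> R xi v t) ->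
  (forall xi u, (forall zeta, zeta < xi -> R zeta u (u zeta)) ->
     exists t, R xi u t) ->
  exists h : On -> T, forall xi, R xi h (h xi).
Proof.
move=> Rext Rex.
pose pick (P : T -> Prop) : T :=
  if pselect (exists t, P t) is left e then projT1 (cid e) else t0.
have pickP P : (exists t, P t) -> P (pick P).
  by move=> e; rewrite /pick; case: pselect => // e'; case: cid.
(* The default [t0] is harmless: by [Rext], values at exponents outside [zeta < xi] do not affect
   [R xi]. *)
pose ext xi (r : forall zeta, zeta < xi -> T) (zeta : On) : T :=
  if pselect (zeta < xi) is left lt then r zeta lt else t0.
pose step xi r := pick (R xi (ext xi r)).
pose h := Fix On_lt_wf (fun=> T) step.
have hE xi : h xi = pick (R xi (ext xi (fun zeta _ => h zeta))).
  rewrite /h Fix_eq // => a u v uv; congr step.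
  by apply: functional_extensionality_dep => b; apply: funext => ba.
exists h => a; elim/On_ind: a => xi IH.
have extE zeta : zeta < xi -> ext xi (fun zeta _ => h zeta) zeta = h zeta.
  by rewrite /ext; case: pselect.
rewrite [h in R _ _ h]hE.
apply: (Rext _ _ _ _ extE); apply: pickP; apply: Rex => zeta zxi.
rewrite extE //; apply: Rext (IH _ zxi) => eta ez.
by rewrite extE //; apply: lt_trans zxi.
Qed.

(* [C m] is the order type of the elements of [D] below [m]. *)
Lemma collapse_ex (D : On -> Prop) : exists C : On -> On,
  forall m y, y < C m <-> exists2 x, x < m & D x /\ y <= C x.
Proof.
apply: (@On_rec_ex On On0 (fun m C c =>
  forall y, y < c <-> exists2 x, x < m & D x /\ y <= C x)).
  move=> m u v c uv cP y; rewrite cP.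
  by split=> -[x xm]; exists x => //; [rewrite -uv|rewrite uv].
move=> m u _.
(* Points outside [D] contribute [On0], hence nothing; the successor turns [y <= u x] into
   [y < F x]. *)
pose F x := if pselect (D x) then On_succ (u x) else On0.
have [c lc] := On_lub_lt_ex F m.
exists c => y; split=> [/(lub_ltP lc)[_ [x /= xm <-]]|[x xm [Dx yx]]].
  by rewrite /F; case: pselect => Dx; rewrite ?On_lt0 // On_ltS => yx; exists x.
apply: (@lt_le_trans _ _ (F x)); last by apply: lc.1; exists x.
by rewrite /F; case: (pselect (D x)) => // ?; rewrite On_ltS.
Qed.

(** * Construction of a weak cohyperation by recursion on the exponent *)

Section Construction.
Variable g : On -> On.
Hypothesis g_initial : initial g.

Definition common_fixed (u : On -> On -> On) (xi x : On) : Prop :=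
  forall zeta, zeta < xi -> u zeta x = x.

(* [t] is an admissible value at [xi] of a weak cohyperation that is given by
   [u] below [xi]. [coh_mono] stands in for maximality: once no [u zeta] moves
   the argument any more, [t] should not lose information. *)
Record coh_step (xi : On) (u : On -> On -> On) (t : On -> On) : Prop := CohStep {
  coh_initial : initial t;
  coh0 : xi = On0 -> t =1 id;
  coh1 : xi = On1 -> t =1 g;
  coh_add : forall a b, a < xi -> b < xi -> On_add a b = xi ->
    forall x, t x = u b (u a x);
  coh_absorb : forall a, a < xi -> On_add a xi = xi -> forall x, t (u a x) = t x;
  coh_mono : indecomposable xi -> xi <> On0 -> xi <> On1 ->
    forall x y, common_fixed u xi x -> common_fixed u xi y -> x < y -> t x < t y
}.

Lemma coh_step_ext xi u v t : (forall zeta, zeta < xi -> u zeta = v zeta) ->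
  coh_step xi u t -> coh_step xi v t.
Proof.
move=> uv [Ht0 Ht1 Ht2 Ht3 Ht4 Ht5]; split=> //.
- by move=> a b axi bxi abxi x; rewrite -!uv //; apply: Ht3.
- by move=> a axi abxi x; rewrite -!uv //; apply: Ht4.
- by move=> ixi x0 x1 x y Dx Dy; apply: Ht5 => // zeta zxi; rewrite uv //; auto.
Qed.

(** Beyond [coh_add] there remain the splittings with a summand equal to [xi]: [a = xi] forces
    [b = On0], and [b = xi] is [coh_absorb]. *)
Lemma coh_step_le xi u : (forall zeta, zeta <= xi -> coh_step zeta u (u zeta)) ->
  forall a b, On_add a b = xi -> forall x, u xi x = u b (u a x).
Proof.
move=> uP a b abxi x.
have u0 y : u On0 y = y by apply: (coh0 (uP _ (On_le0x xi))).
have: a <= xi by rewrite -abxi On_le_addr.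
rewrite le_eqVlt => /predU1P[axi|axi].
  have -> : b = On0 by apply: (@On_add_inj a); rewrite abxi On_add0.
  by rewrite u0 axi.
have: b <= xi by rewrite -abxi On_le_addl.
rewrite le_eqVlt => /predU1P[bxi|bxi].
  rewrite bxi in abxi *; exact: (esym (coh_absorb (uP xi (lexx _)) axi abxi x)).
exact: (coh_add (uP xi (lexx _))).
Qed.

Lemma coh_step_decomposable xi u : ~ indecomposable xi ->
  (forall zeta, zeta < xi -> coh_step zeta u (u zeta)) ->
  exists t, coh_step xi u t.
Proof.
(* All splittings [xi = a + b] give the same composition: of two splittings,
   one refines the other. *)
move=> nixi uP.
have uD a b : On_add a b < xi -> forall x, u (On_add a b) x = u b (u a x).
  move=> abxi; apply: coh_step_le => // zeta zab.
  by apply: uP; apply: le_lt_trans abxi.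
have uDD a b c d : a <= c -> c < xi -> b < xi ->
    On_add a b = On_add c d -> forall x, u b (u a x) = u d (u c x).
  move=> ac cxi bxi; have [e _ ce] := On_sub ac; subst c.
  rewrite On_addA => /On_add_inj bE x; rewrite bE in bxi *.
  by rewrite !uD.
have [c [d [cxi dxi cd]]] := decomposableP nixi.
have uE a b : a < xi -> b < xi -> On_add a b = xi ->
    forall x, u d (u c x) = u b (u a x).
  move=> axi bxi ab x; have [ac|/ltW ca] := leP a c.
    by rewrite -(uDD a b c d) // ab cd.
  by rewrite (uDD c d a b) // ab cd.
exists (u d \o u c); split=> //.
- by apply: initial_comp; apply: coh_initial; apply: uP.
- by move=> xi0; case: nixi; rewrite xi0; apply: indecomposable0.
- by move=> xi1; case: nixi; rewrite xi1; apply: indecomposable1.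
(* Since [(a + c) + d] is another splitting of [xi], absorption is an instance of [uE]. *)
move=> a axi abs x /=.
have ac : On_add a c < xi.
  rewrite -[ltRHS]abs; apply: On_add_lt; exact: cxi.
by rewrite -(uD a c) //; apply: esym; apply: uE; rewrite // On_addA cd.
Qed.

Lemma coh_step_indecomposable xi u :
  indecomposable xi -> xi <> On0 -> xi <> On1 ->
  (forall zeta, zeta < xi -> coh_step zeta u (u zeta)) ->
  exists t, coh_step xi u t.
Proof.
(* [t x] is the position, among the common fixed points of the [u zeta], of the
   least value that the [u zeta] reach from [x]. *)
move=> ixi xi0 xi1 uP.
have uD a b : On_add a b < xi -> forall x, u (On_add a b) x = u b (u a x).
  move=> abxi; apply: coh_step_le => // zeta zab.
  by apply: uP; apply: le_lt_trans abxi.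
have u0 x : u On0 x = x.
  by apply: (coh0 (uP _ (On_gt0 xi0))).
have ule a x : a < xi -> u a x <= x.
  by move=> axi; apply: initial_le; apply: coh_initial; apply: uP.
have /choice[m mP] : forall x, exists y,
    (exists2 zeta, zeta < xi & y = u zeta x) /\
    forall zeta, zeta < xi -> y <= u zeta x.
  move=> x; have [y [yP _ ymin]] := @On_least
    (fun y => exists2 zeta, zeta < xi & y = u zeta x) (u On0 x)
    (ex_intro2 _ _ On0 (On_gt0 xi0) erefl).
  by exists y; split=> // zeta zxi; apply: ymin; exists zeta.
have mle x : m x <= x by rewrite -[leRHS]u0; apply: (mP x).2; apply: On_gt0.
have Dm x : common_fixed u xi (m x).
  (* If the minimum is reached at [b], then [b + a] is still below [xi], so [u a] cannot lower
     it. *)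
  move=> a axi; apply: le_anti; rewrite ule //=.
  have [[b bxi mb] mmin] := mP x.
  by rewrite [in leRHS]mb -uD; [apply: mmin|]; apply: ixi.
have mE x : common_fixed u xi x -> m x = x.
  by move=> Dx; have [[b bxi ->] _] := mP x; apply: Dx.
have m_absorb a x : a < xi -> m (u a x) = m x.
  move=> axi; apply: le_anti; apply/andP; split; last first.
    have [[c cxi ->] _] := mP (u a x).
    by rewrite -uD; [apply: (mP x).2|]; apply: ixi.
  (* If [a <= b], the remainder [b - a] leads from [u a x] to [m x]. Otherwise [u a x] already
     equals [m x], which the remainder [a - b] fixes. *)
  have [[b bxi mb] _] := mP x; have [ab|ba] := leP a b.
    have [e eb ae] := On_sub ab; rewrite mb -ae uD ?ae //.
    by apply: (mP _).2; apply: le_lt_trans bxi.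
  have [e ea be] := On_sub (ltW ba).
  suff <- : u a x = m x by apply: mle.
  by rewrite -[in LHS]be uD ?be // -mb Dm //; apply: le_lt_trans axi.
have [C CP] := collapse_ex (common_fixed u xi).
exists (C \o m); split=> //=.
- apply/initialP => x y /=.
  have Cim z : y < C z -> exists2 w, w < z & common_fixed u xi w /\ C w = y.
    elim/On_ind: z => z IH /CP[w wz [Dw]].
    rewrite le_eqVlt => /predU1P[-> |/(IH _ wz)[w' w'w ?]]; first by exists w.
    by exists w' => //; apply: lt_trans wz.
  move=> /Cim[w wm [Dw <-]]; exists w; first exact: lt_le_trans (mle x).
  by rewrite mE.
- by move=> a b axi bxi abxi; have := ixi a b axi bxi; rewrite abxi ltxx.
- by move=> a axi _ x; rewrite m_absorb.
- by move=> _ _ _ x y Dx Dy xy; rewrite !mE //; apply/CP; exists x.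
Qed.

Lemma coh_ex : exists h, forall xi, coh_step xi h (h xi).
Proof.
apply: (On_rec_ex id); first exact: coh_step_ext.
move=> xi u uP.
have [ixi|nixi] := pselect (indecomposable xi); last exact: coh_step_decomposable.
have [xi0|xi0] := pselect (xi = On0).
  exists id; split=> //.
  - by apply/initialP => x y yx; exists y.
  - by rewrite xi0 => xi1; have := On_succ_gt On0; rewrite -/On1 -xi1 ltxx.
  - by move=> a b; rewrite xi0 On_lt0.
  - by move=> a; rewrite xi0 On_lt0.
have [xi1|xi1] := pselect (xi = On1); last exact: coh_step_indecomposable.
have u0 x : u On0 x = x by apply: (coh0 (uP _ (On_gt0 xi0))).
exists g; split=> //.
- by move=> a b axi bxi abxi; have := ixi a b axi bxi; rewrite abxi ltxx.
- by move=> a; rewrite xi1 => /On_lt1-> _ x; rewrite u0.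
Qed.

End Construction.

(** * The functions [L xi] with left adjoint [h xi], compared with weak hyperations and
    cohyperations *)

Section RightAdjoint.
Variables (f g : On -> On) (h L : On -> On -> On).
Hypothesis f_normal : normal f.
Hypothesis fg : left_adjoint f g.
Hypothesis hP : forall xi, coh_step g xi h (h xi).

Lemma coh_stepD a b x : h (On_add a b) x = h b (h a x).
Proof. by apply: coh_step_le. Qed.

Lemma coh_step_weak : weak_cohyperation g h.
Proof.
split=> [xi|a|a|]; last exact: coh_stepD.
- exact: coh_initial (hP xi).
- exact: (coh0 (hP On0)).
- exact: (coh1 (hP On1)).
Qed.

(** At an indecomposable [xi] above [On1] the points [F xi c] are common fixed points, so [coh_mono]
    makes [h xi] strictly increasing along them and [b <= h xi (F xi b)]. The lemma serves to make
    [h xi] onto and to place [L] below [F]. *)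
Lemma coh_below_hyperation F xi b : weak_hyperation f F ->
  exists2 a, a <= F xi b & h xi a = b.
Proof.
move=> [Fn F0 F1 FD]; elim/exponent_ind: xi b => [b|b|xi zeta IHx IHz b|xi ixi xi0 xi1 IH b].
- by exists b; rewrite ?F0 // (coh0 (hP On0)).
- by exists (f b); rewrite ?F1 // (coh1 (hP On1)) // (left_adjointK fg).
- have [y yb hy] := IHz b; have [x xy hx] := IHx y.
  exists x; last by rewrite coh_stepD hx.
  by rewrite FD; apply: le_trans xy _; apply: normal_homo_le.
apply: initial_onto; first exact: coh_initial (hP xi).
have DF c : common_fixed h xi (F xi c).
  (* Here [F xi c] is the value of [h zeta] at some [a] no larger than itself, and [h zeta a <= a]
     forces equality. *)
  move=> zeta zxi; have [a] := IH zeta zxi (F xi c).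
  rewrite -FD indecomposable_absorb // => aF ha.
  suff aE : a = F xi c by rewrite -{1}aE.
  by apply: le_anti; rewrite aF -{1}ha initial_le //; apply: coh_initial.
elim/On_ind: b => b IHb; apply: On_le_of_lt => c cb.
apply: le_lt_trans (IHb c cb) _.
by apply: (coh_mono (hP xi)) => //; apply: (Fn xi).1.
Qed.

Hypothesis Lh : forall xi, left_adjoint (L xi) (h xi).

Lemma adjoint0 b : L On0 b = b.
Proof.
apply: (left_adjoint_uniq (Lh On0)) => a c.
by rewrite (coh0 (hP On0)).
Qed.

Lemma adjoint1 b : L On1 b = f b.
Proof.
apply: (left_adjoint_uniq (Lh On1)) => a c.
by rewrite (coh1 (hP On1)).
Qed.

Lemma adjointD a b x : L (On_add a b) x = L a (L b x).
Proof.
apply: (left_adjoint_uniq (f' := L a \o L b) (Lh (On_add a b))) => y c; rewrite coh_stepD.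
exact: (left_adjoint_comp (Lh a) (Lh b) y c).
Qed.

(** Absorption gives [L zeta (L xi b) = L xi b], and [h zeta] undoes [L zeta]. *)
Lemma adjoint_common_fixed xi b : indecomposable xi -> common_fixed h xi (L xi b).
Proof.
move=> ixi zeta zxi.
by rewrite -{1}(indecomposable_absorb ixi zxi) adjointD (left_adjointK (Lh zeta)).
Qed.

Lemma adjoint_normal xi : normal (L xi).
Proof.
elim/exponent_ind: xi => [||a b na nb|xi ixi xi0 xi1 IH].
- rewrite (_ : L On0 = id); last exact/funext/adjoint0.
  split=> // l ll; rewrite image_id; split=> [x /ltW //|c cub].
  by apply: On_le_of_lt => x /(On_limit_succ ll)/cub; rewrite On_succ_le.
- by rewrite (_ : L On1 = f) //; apply/funext/adjoint1.
- rewrite (_ : L (On_add a b) = L a \o L b); first exact: normal_comp.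
  exact/funext/adjointD.
have Linc := left_adjoint_homo (Lh xi); split=> // l ll.
split=> [_ [b /= bl <-]|c cub]; first exact/ltW/Linc.
(* The supremum [s] is a common fixed point, because each [L zeta] is continuous and fixes every
   [L xi x]. Then [coh_mono] gives [l <= h xi s], whence [L xi l <= s]. *)
have [s ls] := On_lub_lt_ex (L xi) l.
apply: (le_trans _ (ls.2 _ cub)); rewrite leNgt; apply/negP.
move=> /(left_adjoint_lt (Lh xi)); apply/negP; rewrite -leNgt.
have Ds : common_fixed h xi s.
  move=> zeta zxi; suff {1}<- : L zeta s = s by rewrite (left_adjointK (Lh zeta)).
  have n0 : L xi @` [set x | x < l] !=set0.
    by exists (L xi On0), On0 => //=; apply: On_gt0 ll.1.
  have := normal_lub (IH zeta zxi) n0 ls.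
  rewrite image_comp (_ : L zeta \o L xi = L xi); first last.
    by apply/funext => x /=; rewrite -adjointD indecomposable_absorb.
  move=> ls'; apply: le_anti.
  by rewrite (ls'.2 _ ls.1) (ls.2 _ ls'.1).
apply: On_le_of_lt => b bl; rewrite -(left_adjointK (Lh xi) b).
apply: (coh_mono (hP xi)) => //; first exact: adjoint_common_fixed.
apply: (lt_le_trans (Linc _ _ (On_succ_gt b))).
by apply: ls.1; exists (On_succ b) => //=; apply: On_limit_succ.
Qed.

(* The supremum of the [L zeta (On_succ (L xi b))] is a common fixed point above
   [L xi b], so it bounds [L xi (On_succ b)]. *)
Lemma adjoint_succ xi b a : indecomposable xi -> xi <> On0 -> xi <> On1 ->
  a < L xi (On_succ b) -> exists2 zeta, zeta < xi & a < L zeta (On_succ (L xi b)).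
Proof.
move=> ixi xi0 xi1 ab; set mu := L xi b.
have [s ls] := On_lub_lt_ex (fun zeta => L zeta (On_succ mu)) xi.
suff /(lt_le_trans ab)/(lub_ltP ls)[_ [zeta /= zxi <-]] : L xi (On_succ b) <= s.
  by exists zeta.
rewrite leNgt; apply/negP => /(left_adjoint_lt (Lh xi)); rewrite On_ltS leNgt.
apply/negP; rewrite negbK -[ltLHS](left_adjointK (Lh xi)).
apply: (coh_mono (hP xi)) => //; first exact: adjoint_common_fixed; last first.
  apply: (lt_le_trans (On_succ_gt _)).
  by apply: ls.1; exists On0 => /=; rewrite ?adjoint0 //; apply: On_gt0.
move=> zeta zxi; suff {1}<- : L zeta s = s by rewrite (left_adjointK (Lh zeta)).
(* One inequality holds because [h zeta] never raises its argument; the other is continuity of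
   [L zeta], as [zeta + eta] stays below [xi]. *)
apply: le_anti; apply/andP; split; last first.
  rewrite -[leLHS](left_adjointK (Lh zeta)); apply: initial_le.
  exact: coh_initial (hP zeta).
have n0 : [set L eta (On_succ mu) | eta in [set eta | eta < xi]] !=set0.
  by eexists; exists On0 => //=; apply: On_gt0.
apply: (normal_lub (adjoint_normal zeta) n0 ls).2 => _ [_ [eta /= exi <-] <-].
rewrite -adjointD; apply: ls.1; exists (On_add zeta eta) => //=.
exact: ixi.
Qed.

Lemma adjoint_weak : weak_hyperation f L.
Proof.
split; [exact: adjoint_normal|exact: adjoint0|exact: adjoint1|exact: adjointD].
Qed.

(** This supplies the strict half of the adjunction. At an indecomposable exponent above [On1] an
    inner induction on [b] is run. *)
Lemma weak_cohyperation_lt k xi a b : weak_cohyperation g k ->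
  a < L xi b -> k xi a < b.
Proof.
move=> [ki k0 k1 kD].
elim/exponent_ind: xi a b => [a b|a b|xi zeta IHx IHz a b|xi ixi xi0 xi1 IH a b].
- by rewrite adjoint0 k0.
- by rewrite adjoint1 k1 => /(left_adjoint_lt fg).
- by rewrite adjointD kD => /IHx/IHz.
elim/On_ind: b a => b IHb a ab; have [b0|[c bc]|lb] := On_cases b.
- by have := left_adjoint_lt (Lh xi) ab; rewrite b0 On_lt0.
- have cb : c < b by rewrite bc On_succ_gt.
  rewrite bc in ab *; have [zeta zxi /(IH _ zxi)] := adjoint_succ ixi xi0 xi1 ab.
  (* Absorption gives [k xi a = k xi (k zeta a)] with [k zeta a <= L xi c]. If [k xi] exceeded [c]
     at [L xi c], initiality would put the value [c] at a smaller point, against [IHb]. *)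
  rewrite !On_ltS -(indecomposable_absorb ixi zxi) kD indecomposable_absorb //.
  rewrite le_eqVlt => /predU1P[->|/(IHb c cb)/ltW //].
  rewrite leNgt; apply/negP => /((initialP _).1 (ki xi))[x /(IHb c cb) + kx].
  by rewrite kx ltxx.
have [_ [c /= cb <-] /(IHb c cb)] := lub_ltP ((adjoint_normal xi).2 _ lb) ab.
by move=> /lt_trans; apply.
Qed.

End RightAdjoint.

Theorem theorem9p1 (f : On -> On) (fh : On -> On -> On)
    (g : On -> On) (gh : On -> On -> On) :
  normal f ->
  hyperation f fh ->
  left_adjoint f g ->
  cohyperation g gh ->
  forall xi : On, left_adjoint (fh xi) (gh xi).
Proof.
move=> nf [fw fmin] fg [gw gmax] xi.
have [fhn _ _ _] := fw; have [h hP] := coh_ex (left_adjoint_initial fg).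
have /choice[L Lh] zeta : exists l, left_adjoint l (h zeta).
  apply: initial_surj_adjoint; first exact: coh_initial (hP zeta).
  by move=> b; have [a _ <-] := coh_below_hyperation fg hP zeta b fw; exists a.
have fhL b : fh xi b = L xi b.
  apply: le_anti; apply/andP; split.
    by apply: fmin; apply: adjoint_weak nf fg hP Lh.
  (* Some preimage of [b] under [h xi] lies at or below [fh xi b], and no preimage lies below
     [L xi b]. *)
  have [a afb hab] := coh_below_hyperation fg hP xi b fw.
  apply: le_trans afb; rewrite leNgt; apply/negP => /(left_adjoint_lt (Lh xi)).
  by rewrite hab ltxx.
have up a b : a < fh xi b -> gh xi a < b.
  by rewrite fhL; exact: (weak_cohyperation_lt nf fg hP Lh gw).
move=> a b; split=> [->|]; last exact: up.
(* Upper bound: [fh xi b < fh xi (On_succ b)], so [up] applies at [On_succ b]. Lower bound: [gh xi]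
   dominates [h xi], which takes the value [b] at [L xi b]. *)
apply: le_anti; rewrite -On_ltS up /=; last exact/(fhn xi).1/On_succ_gt.
rewrite -[leLHS](left_adjointK (Lh xi)) fhL; apply: gmax.
exact: coh_step_weak hP.
Qed.
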